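(* For every $A\subseteq\mathcal{P}(\omega)$ such that $|A|\leq\aleph_0$, there exist $2^{\aleph_0}$ $A$-typical reals, while the set of reals that are not $A$-typical has cardinality strictly less than $2^{\aleph_0}$. More precisely: for every finite (or even countable) tuple $\overline{b}$ of reals, $|\{x\in\mathcal{P}(\omega):\mathsf{Tp}(x,\overline{b})\}|=2^{\aleph_0}$, while $|\{x\in\mathcal{P}(\omega):\neg\mathsf{Tp}(x,\overline{b})\}|<2^{\aleph_0}$.
   Context: Reals are elements of $\mathcal{P}(\omega)$. $L_2=\{+,\cdot,<,\in,0,1\}$ is the two-sorted first-order language of second-order arithmetic, with number variables and set (real) variables, and $\mathcal{R}=(\omega,\mathcal{P}(\omega),+,\cdot,<,\in,0,1)$ is its full standard model (number variables range over $\omega$, set variables over $\mathcal{P}(\omega)$). For $A\subseteq\mathcal{P}(\omega)$, a property of $L_2(A)$ is an $L_2$-formula $\phi(x,\overline{d})$ with one free variable $x$, ranging over reals, and finitely many parameters $\overline{d}$ from $A$. Such a property is $A$-typical if its extension is a majority subset of $\mathcal{P}(\omega)$, i.e. $|\{x\in\mathcal{P}(\omega):\mathcal{R}\not\models\phi(x,\overline{d})\}|<2^{\aleph_0}$. A real $a$ is $A$-typical if $\mathcal{R}\models\phi(a,\overline{d})$ for every $A$-typical property $\phi(x,\overline{d})$. Equivalently, $a$ is $A$-typical iff for every $L_2$-formula $\phi(x,\overline{y})$ and every finite tuple $\overline{d}$ from $A$ with $\mathcal{R}\models\phi(a,\overline{d})$, one has $|\{x:\mathcal{R}\models\phi(x,\overline{d})\}|=2^{\aleph_0}$.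 For a tuple $\overline{b}$ of reals, $\mathsf{Tp}(a,\overline{b})$ means that $a$ is $A$-typical where $A$ is the set of entries of $\overline{b}$. *)

(* Defs.v *)
From mathcomp Require Import all_boot.
From mathcomp Require Export boolp classical_sets functions cardinality.

Set Implicit Arguments.
Unset Strict Implicit.
Unset Printing Implicit Defensive.

Local Open Scope classical_set_scope.
Local Open Scope card_scope.

Definition Real := set nat.

(* Well-scoped de Bruijn syntax: [formula m n] has its free number variables
   among 'I_m and its free set variables among 'I_n; a quantifier binds
   index 0 of its sort and shifts the other indices of that sort by one.
   Equality is a logical symbol, available for both sorts. *)

Inductive term (m : nat) : Type :=
| TVar of 'I_m
| TZero
| TOne
| TAdd of term m & term m
| TMul of term m & term m.

Inductive formula (m n : nat) : Type :=
| FEqN of term m & term m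
| FEqS of 'I_n & 'I_n
| FLt of term m & term m
| FIn of term m & 'I_n
| FNot of formula m n
| FAnd of formula m n & formula m n
| FOr of formula m n & formula m n
| FImp of formula m n & formula m n
| FAllN of formula m.+1 n
| FExN of formula m.+1 n
| FAllS of formula m n.+1
| FExS of formula m n.+1.

Definition extend (T : Type) (n : nat) (x : T) (e : 'I_n -> T) (i : 'I_n.+1) : T :=
  if unlift ord0 i is Some j then e j else x.

Fixpoint eval (m : nat) (e : 'I_m -> nat) (t : term m) : nat :=
  match t with
  | TVar i => e i
  | TZero => 0
  | TOne => 1
  | TAdd t1 t2 => eval e t1 + eval e t2
  | TMul t1 t2 => eval e t1 * eval e t2
  end.

(* Satisfaction in the full standard model: number quantifiers range over
   [nat] and set quantifiers over all of [Real]. *)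
Fixpoint sat (m n : nat) (e : 'I_m -> nat) (E : 'I_n -> Real)
    (phi : formula m n) : Prop :=
  match phi with
  | FEqN t1 t2 => eval e t1 = eval e t2
  | FEqS X Y => E X = E Y
  | FLt t1 t2 => eval e t1 < eval e t2
  | FIn t X => E X (eval e t)
  | FNot p => ~ sat e E p
  | FAnd p q => sat e E p /\ sat e E q
  | FOr p q => sat e E p \/ sat e E q
  | FImp p q => sat e E p -> sat e E q
  | FAllN p => forall k : nat, sat (extend k e) E p
  | FExN p => exists k : nat, sat (extend k e) E p
  | FAllS p => forall X : Real, sat e (extend X E) p
  | FExS p => exists X : Real, sat e (extend X E) p
  end.

Definition no_numbers (i : 'I_0) : nat := i.

(* A property phi(x, d) of L_2(A): set variable 0 of the formula is x, and the
   set variable i+1 is interpreted by the parameter d_i. *)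
Record property (A : set Real) : Type := Property {
  arity : nat;
  body : formula 0 arity.+1;
  param : 'I_arity -> Real;
  param_in : forall i, A (param i)
}.

Definition extension (A : set Real) (P : property A) : set Real :=
  [set x | sat no_numbers (extend x (@param A P)) (body P)].

Definition card_lt (T U : Type) (X : set T) (Y : set U) : Prop :=
  X #<= Y /\ ~ (Y #<= X).

(* The cardinal 2^aleph_0 is represented by [set: Real], the powerset of omega. *)
Definition majority (X : set Real) : Prop := card_lt (~` X) [set: Real].

Definition typical_property (A : set Real) (P : property A) : Prop :=
  majority (extension P).

Definition typical (A : set Real) (a : Real) : Prop :=
  forall P : property A, typical_property P -> extension P a.

Definition Tp (I : Type) (a : Real) (b : I -> Real) : Prop :=
  typical (range b) a.

(* Main.v *)
Require Import Defs.
From mathcomp Require Import all_boot.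
From mathcomp Require Import boolp classical_sets functions cardinality.

(** A real fails to be [A]-typical exactly when it lies in the exceptional set
    of some [A]-typical property, and each exceptional set has fewer than
    continuum many elements. There are countably many formulas, hence countably
    many properties when [A] is countable ([countable_property]). So the
    non-typical reals form a countable union of sets smaller than the continuum,
    and by König's theorem, in the form that the continuum has uncountable
    cofinality, such a union is again smaller than the continuum
    ([konig_bigcup]). Consequently the typical reals are continuum many:
    otherwise the set of all reals would itself be a union of two sets smaller
    than the continuum.

    For a set of reals, being smaller than the continuum amounts to the absence
    of an injection from the reals into it. The lemmas are phrased with this
    absence, so that comparability of cardinals never enters. *)

Local Open Scope classical_set_scope.
Local Open Scope card_scope.

(** A real codes countably many reals, its rows; so the continuum [c] satisfies
    [c ^ aleph_0 = c], which is what the diagonal argument below needs. *)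
Definition row (x : Real) (i : nat) : Real := [set k | x (pickle (i, k))].

Lemma row_surj (h : nat -> Real) : exists x : Real, row x = h.
Proof.
exists [set m | if unpickle m is Some (i, k) then h i k else False].
by apply/funext => i; apply/funext => k; rewrite /row /= pickleK.
Qed.

(** König's diagonal argument. If the union mapped onto the reals, hence onto
    the sequences of reals, then no [F i] would reach all values of the
    [i]-th coordinate; a sequence that avoids, at each coordinate [i], the
    values reached from [F i] has no preimage in the union. *)
Lemma konig_bigcup (I T : Type) (D : set I) (F : I -> set T) :
  countable D -> (forall i, D i -> ~ ([set: Real] #<= F i)) ->
  ~ ([set: Real] #<= \bigcup_(i in D) F i).
Proof.
move=> /countable_injP[c c_inj] F_small /(@pcard_surjP (set nat))[g g_surj].
have avoid n : exists y : Real,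
    forall i x, D i -> c i = n -> F i x -> row (g x) n <> y.
  have [[i [Di <-]]|no_i] := pselect (exists i, D i /\ c i = n); last first.
    (* [n] codes no index: any real avoids the empty set of values. *)
    by exists (fun=> False) => i x Di ci; case: no_i; exists i.
  apply: contrapT => all_reached; apply: (F_small i Di).
  apply/(@pcard_surjP (set nat)).
  exists (fun x => row (g x) (c i)) => y _.
  apply: contrapT => y_missed; apply: all_reached; exists y => j x Dj cji Fjx gxy.
  apply: y_missed; exists x => //.
  by rewrite -(c_inj j i (mem_set Dj) (mem_set Di) cji).
have [h hP] := choice avoid.
have [z zh] := row_surj h.
have [x [i Di Fix] gxz] := g_surj z Logic.I.
by apply: (hP (c i) i x Di erefl Fix); rewrite gxz zh.
Qed.

(** If neither [X] nor its complement had continuum many elements, König's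
    argument for a union of two sets would make the set of all reals smaller
    than itself. *)
Lemma card_setC_small (X : set Real) :
  ~ ([set: Real] #<= ~` X) -> X #= [set: Real].
Proof.
move=> XC_small; apply: Cantor_Bernstein; first exact: card_leT.
apply: contrapT => X_small.
apply: (@konig_bigcup bool Real setT (fun b => if b then X else ~` X)) => //.
  by case.
suff -> : \bigcup_(b in setT) (if b then X else ~` X) = [set: Real] by [].
apply/seteqP; split=> // x _.
by have [Xx|nXx] := pselect (X x); [exists true | exists false].
Qed.

Fixpoint term_code m (t : term m) : GenTree.tree nat :=
  match t with
  | TVar i => GenTree.Leaf (i : nat)
  | TZero => GenTree.Node 0 [::]
  | TOne => GenTree.Node 1 [::]
  | TAdd t u => GenTree.Node 2 [:: term_code _ t; term_code _ u]
  | TMul t u => GenTree.Node 3 [:: term_code _ t; term_code _ u]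
  end.

Fixpoint formula_code m n (p : formula m n) : GenTree.tree nat :=
  match p with
  | FEqN t u => GenTree.Node 0 [:: term_code _ t; term_code _ u]
  | FEqS X Y => GenTree.Node 1 [:: GenTree.Leaf (X : nat); GenTree.Leaf (Y : nat)]
  | FLt t u => GenTree.Node 2 [:: term_code _ t; term_code _ u]
  | FIn t X => GenTree.Node 3 [:: term_code _ t; GenTree.Leaf (X : nat)]
  | FNot p => GenTree.Node 4 [:: formula_code _ _ p]
  | FAnd p q => GenTree.Node 5 [:: formula_code _ _ p; formula_code _ _ q]
  | FOr p q => GenTree.Node 6 [:: formula_code _ _ p; formula_code _ _ q]
  | FImp p q => GenTree.Node 7 [:: formula_code _ _ p; formula_code _ _ q]
  | FAllN p => GenTree.Node 8 [:: formula_code _ _ p]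
  | FExN p => GenTree.Node 9 [:: formula_code _ _ p]
  | FAllS p => GenTree.Node 10 [:: formula_code _ _ p]
  | FExS p => GenTree.Node 11 [:: formula_code _ _ p]
  end.

Lemma term_code_inj m : injective (@term_code m).
Proof.
elim=> [i|||t IHt u IHu|t IHt u IHu] [j|||t' u'|t' u'] //=.
- by move=> [/val_inj->].
- by move=> [/IHt-> /IHu->].
- by move=> [/IHt-> /IHu->].
Qed.

Lemma formula_code_inj m n : injective (@formula_code m n).
Proof.
move=> p; elim: p => {}m {}n.
- by move=> t u [] //= ? ? [/term_code_inj-> /term_code_inj->].
- by move=> X Y [] //= ? ? [/val_inj-> /val_inj->].
- by move=> t u [] //= ? ? [/term_code_inj-> /term_code_inj->].
- by move=> t X [] //= ? ? [/term_code_inj-> /val_inj->].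
- by move=> p IHp [] //= ? [/IHp->].
- by move=> p IHp q IHq [] //= ? ? [/IHp-> /IHq->].
- by move=> p IHp q IHq [] //= ? ? [/IHp-> /IHq->].
- by move=> p IHp q IHq [] //= ? ? [/IHp-> /IHq->].
- by move=> p IHp [] //= ? [/IHp->].
- by move=> p IHp [] //= ? [/IHp->].
- by move=> p IHp [] //= ? [/IHp->].
- by move=> p IHp [] //= ? [/IHp->].
Qed.

(** A property is a formula together with a finite tuple from [A], so a coding
    of the elements of [A] by numbers extends to a coding of properties. *)
Lemma countable_property (A : set Real) :
  countable A -> countable [set: property A].
Proof.
move=> /countable_injP[c c_inj].
pose code (P : property A) :=
  (arity P, formula_code _ _ (body P), [seq c (@param A P i) | i : 'I_(arity P)]).
apply/countable_injP; exists (pickle \o code).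
move=> P Q _ _ /(pcan_inj pickleK); rewrite {}/code.
case: P Q => [n p d dA] [n' p' d' d'A] /= [nn'].
move: p' d' d'A; rewrite -{}nn' => p' d' d'A.
move=> /formula_code_inj <- /eq_in_map cd.
have dd' : d = d'.
  by apply/funext => i; apply: c_inj; rewrite ?mem_set// cd// mem_enum.
by move: d'A; rewrite -dd' => d'A; rewrite (Prop_irrelevance dA d'A).
Qed.

Lemma nontypical_small (A : set Real) : countable A ->
  ~ ([set: Real] #<= [set a | ~ typical A a]).
Proof.
move=> A_countable.
have -> : [set a | ~ typical A a] =
    \bigcup_(P in @typical_property A) ~` extension P.
  apply/seteqP; split=> [a /existsNP[P /not_implyP[tP nPa]]|a [P tP nPa] ta].
    by exists P.
  exact/nPa/ta.
apply: konig_bigcup => [|P [_ PC_small]]; last exact: PC_small.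
by apply: (@sub_countable _ _ _ [set: property A]);
  [exact: card_leT | exact: countable_property].
Qed.

Lemma typical_card (A : set Real) : countable A ->
  [set a | typical A a] #= [set: Real] /\
  card_lt [set a | ~ typical A a] [set: Real].
Proof.
move=> /nontypical_small small; split; first exact: card_setC_small.
by split; first exact: card_leT.
Qed.

Theorem theorem2p11 :
  (forall A : set Real, countable A ->
     [set a : Real | typical A a] #= [set: Real] /\
     card_lt [set a : Real | ~ typical A a] [set: Real]) /\
  (forall (n : nat) (b : 'I_n -> Real),
     [set x : Real | Tp x b] #= [set: Real] /\
     card_lt [set x : Real | ~ Tp x b] [set: Real]) /\
  (forall (I : countType) (b : I -> Real),
     [set x : Real | Tp x b] #= [set: Real] /\
     card_lt [set x : Real | ~ Tp x b] [set: Real]).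
Proof.
have range_countable (I : countType) (b : I -> Real) : countable (range b).
  by apply: sub_countable (card_image_le _ _) (countableP _).
split; first exact: typical_card.
by split=> [n|I] b; apply/typical_card/range_countable.
Qed.
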